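(* Let $P_1$ be the dcpo defined in the context. Then its Scott space $\Sigma P_1$ is sober.
   Context: General notions. A dcpo is a poset in which every directed (nonempty) subset has a supremum. A subset $U$ of a poset $P$ is Scott open if it is an upper set and, for every directed $D\subseteq P$ whose supremum exists, $\sup D\in U$ implies $D\cap U\neq\emptyset$. The Scott open sets form the Scott topology $\sigma(P)$, and $\Sigma P=(P,\sigma(P))$. A $T_0$ space is sober if every nonempty irreducible closed subset is the closure of a unique singleton. $\mathbb{N}$ is the set of non-negative integers. For relations $R,S$, $R;S$ denotes the composition: $x\,(R;S)\,z$ iff there is $y$ with $x\,R\,y$ and $y\,S\,z$. Posets $\mathbb{N}^{<\mathbb{N}}$, $M$, $L$. $\mathbb{N}^{<\mathbb{N}}$ is the set of nonempty finite words over $\mathbb{N}$ with the prefix order. A word of length 1 may be identified with a natural number when indicated; $s.x$ denotes the word $s$ extended by the letter $x\in\mathbb{N}$. $M$ is the disjoint union $\mathbb{N}\cup\mathbb{N}^{<\mathbb{N}}$, where $x\le_M y$ iff either both are in $\mathbb{N}^{<\mathbb{N}}$ and $x$ is a prefix of $y$, or both are in $\mathbb{N}$ and $x\le y$ in the usual order. $L=(\{(a,b)\in\mathbb{N}\times\mathbb{N}:a<b\}\times M)\cup\{\top\}$, where $((a,b),x)\le((a',b'),y)$ iff $a=a'$, $b=b'$ and $x\le_M y$, and $u\le\top$ for all $u\in L$. Write $x_{a,b}$ for $((a,b),x)$. The maps $i$ and $f_{m,n}$. Fix an injection $i:\{(a,b)\in\mathbb{N}\times\mathbb{N}:a<b\}\to\mathcal{P}(\mathbb{N})$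 such that: (1) $i(m_1,n_1)\cap i(m_2,n_2)=\emptyset$ if $(m_1,n_1)\neq(m_2,n_2)$; (2) $n<k$ for every $k\in i(m,n)$; (3) for all $m<n$ there is a monotone injective function $f_{m,n}:\mathbb{N}^{<\mathbb{N}}\to i(m,n)$ (with $i(m,n)\subseteq\mathbb{N}$ in its usual order). Fix such functions $f_{m,n}$. (Such $i$ and $f_{m,n}$ exist.) The poset $B$. $B=\mathbb{N}\times\mathbb{N}\times L$ as a set, with relations (for $a<b$ in $\mathbb{N}$ and $m,n\in\mathbb{N}$): - $(m,n,u)\sqsubset_1(m,n,v)$ whenever $u<v$ in $L$; - $(a,n,x_{a,b})\sqsubset_2(f_{a,b}(x),n+1,\top)$ for all $x\in\mathbb{N}^{<\mathbb{N}}$; - $(b,n,x_{a,b})\sqsubset_3(f_{a,b}(x),n+1,\top)$ for all $x\in\mathbb{N}$ (in $f_{a,b}(x)$, $x$ is read as a word of length 1); - $(f_{a,b}(s),n,x_{a,b})\sqsubset_4(f_{a,b}(s.x),n,\top)$ for all $s\in\mathbb{N}^{<\mathbb{N}}$ and $x\in\mathbb{N}$. Let $\sqsubset$ be $\sqsubset_1\cup\sqsubset_2\cup\sqsubset_3\cup\sqsubset_4\cup(\sqsubset_1;\sqsubset_2)\cup(\sqsubset_1;\sqsubset_3)\cup(\sqsubset_1;\sqsubset_4)$, and let $\sqsubseteq$ be the union of $\sqsubset$ and equality; this is a partial order on $B$. The dcpo $P_1$. Let $\mathbb{N}^{\mathbb{N}}$ be the set of all maps $\mathbb{N}\to\mathbb{N}$,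 and $P_1=(\mathbb{N}^{\mathbb{N}}\times\mathbb{N})\cup B\cup\{\top_1\}$ (disjoint union), with relations: - $(f,n)<_1(f,m)$ whenever $n<m$; - $<_2$ is $\sqsubset$ on $B$; - $(f,n)<_3(f(n),n,\top)$ for all $(f,n)\in\mathbb{N}^{\mathbb{N}}\times\mathbb{N}$; - $x<_4\top_1$ for all $x\in P_1\setminus\{\top_1\}$. The strict order on $P_1$ is $<_1\cup<_2\cup<_3\cup<_4\cup(<_1;<_3)$, and $\le$ is its union with equality. *)

(* Defs.v *)
From HB Require Import structures.
From mathcomp Require Import all_boot all_order.
From mathcomp Require Import boolp classical_sets topology.

Set Implicit Arguments.
Unset Strict Implicit.
Unset Printing Implicit Defensive.

Import Order.TTheory.
Local Open Scope classical_set_scope.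

Section Scott.
Context {d : Order.disp_t} {T : porderType d}.
Implicit Types (D U : set T) (x y z : T).

Definition directed D :=
  D !=set0 /\
  forall x y, D x -> D y -> exists z, [/\ D z, (x <= z)%O & (y <= z)%O].

Definition upper_set U := forall x y, (x <= y)%O -> U x -> U y.

(* [supremums D] is the set of least upper bounds of [D]: empty or a
   singleton. *)
Definition scott_open U :=
  upper_set U /\
  forall D x, directed D -> supremums D x -> U x -> D `&` U !=set0.

Lemma scott_openT : scott_open [set: T].
Proof. by split=> // D x [[y Dy] _] _ _; exists y. Qed.

Lemma scott_openI : setI_closed scott_open.
Proof.
move=> U V [upU oU] [upV oV]; split=> [x y xy [Ux Vx]|D x dirD supx [Ux Vx]].
  by split; [exact: upU xy Ux|exact: upV xy Vx].
have [y [Dy Uy]] := oU D x dirD supx Ux.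
have [z [Dz Vz]] := oV D x dirD supx Vx.
have [w [Dw yw zw]] := dirD.2 y z Dy Dz.
by exists w; split=> //; split; [exact: upU yw Uy|exact: upV zw Vz].
Qed.

Lemma scott_open_bigcup (I : Type) (F : I -> set T) :
  (forall i, scott_open (F i)) -> scott_open (\bigcup_i F i).
Proof.
move=> oF; split=> [x y xy [i _ Fx]|D x dirD supx [i _ Fx]].
  by exists i => //; exact: (oF i).1 xy Fx.
by have [y [Dy Fy]] := (oF i).2 D x dirD supx Fx; exists y; split=> //; exists i.
Qed.

End Scott.

(* The Scott space of a poset: a copy of [T], so that its topology does not
   clash with another one on [T]. *)
Definition scott_space {d : Order.disp_t} (T : porderType d) : Type := T.

HB.instance Definition _ d (T : porderType d) := Choice.on (scott_space T).

HB.instance Definition _ d (T : porderType d) :=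
  isOpenTopological.Build (scott_space T)
    (@scott_openT d T) (@scott_openI d T) (@scott_open_bigcup d T).

Definition irreducible (X : topologicalType) (A : set X) :=
  A !=set0 /\
  forall F G : set X, closed F -> closed G ->
    A `<=` F `|` G -> A `<=` F \/ A `<=` G.

Definition sober (X : topologicalType) :=
  kolmogorov_space X /\
  forall A : set X, closed A -> irreducible A ->
    exists! x : X, A = closure [set x].

Definition word := {s : seq nat | s != [::]}.

Definition le_word (s t : word) : bool := prefix (val s) (val t).

Lemma letter_proof (x : nat) : [:: x] != [::].
Proof. by []. Qed.

Definition letter (x : nat) : word := exist _ [:: x] (letter_proof x).

Lemma word_rcons_proof (s : word) (x : nat) : rcons (val s) x != [::].
Proof. by case: (val s). Qed.

Definition word_rcons (s : word) (x : nat) : word :=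
  exist _ (rcons (val s) x) (word_rcons_proof s x).

Definition ltpair := {ab : nat * nat | ab.1 < ab.2}.

Inductive M := MNat of nat | MWord of word.

Definition leM (x y : M) : bool :=
  match x, y with
  | MNat a, MNat b => a <= b
  | MWord s, MWord t => le_word s t
  | _, _ => false
  end.

(* [LPt p x] is x_{a,b}, for [p] the pair (a,b). *)
Inductive L := LPt of ltpair & M | LTop.

Definition leL (u v : L) : Prop :=
  match u, v with
  | _, LTop => True
  | LPt p x, LPt q y => p = q /\ leM x y
  | LTop, LPt _ _ => False
  end.

Definition ltL (u v : L) : Prop := leL u v /\ u <> v.

Definition B : Type := nat * nat * L.

Definition rel_comp (T : Type) (R S : T -> T -> Prop) (x z : T) : Prop :=
  exists2 y, R x y & S y z.

Section Orders.

(* [f (a,b)] is the map f_{a,b}, seen as taking values in nat.  The relations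
   below are strict orders for every such family. *)
Variable f : ltpair -> word -> nat.

Inductive sq1 : B -> B -> Prop :=
  Sq1 m n u v : ltL u v -> sq1 (m, n, u) (m, n, v).

Inductive sq2 : B -> B -> Prop :=
  Sq2 (p : ltpair) n (x : word) :
    sq2 ((val p).1, n, LPt p (MWord x)) (f p x, n.+1, LTop).

Inductive sq3 : B -> B -> Prop :=
  Sq3 (p : ltpair) n (x : nat) :
    sq3 ((val p).2, n, LPt p (MNat x)) (f p (letter x), n.+1, LTop).

Inductive sq4 : B -> B -> Prop :=
  Sq4 (p : ltpair) n (s : word) (x : nat) :
    sq4 (f p s, n, LPt p (MNat x)) (f p (word_rcons s x), n, LTop).

Definition ltB (x y : B) : Prop :=
  sq1 x y \/ sq2 x y \/ sq3 x y \/ sq4 x y \/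
  rel_comp sq1 sq2 x y \/ rel_comp sq1 sq3 x y \/ rel_comp sq1 sq4 x y.

Inductive P1_carrier := PFun of (nat -> nat) & nat | PB of B | PTop.

Inductive ltP1_1 : P1_carrier -> P1_carrier -> Prop :=
  LtP1_1 g n m : n < m -> ltP1_1 (PFun g n) (PFun g m).

Inductive ltP1_2 : P1_carrier -> P1_carrier -> Prop :=
  LtP1_2 x y : ltB x y -> ltP1_2 (PB x) (PB y).

Inductive ltP1_3 : P1_carrier -> P1_carrier -> Prop :=
  LtP1_3 g n : ltP1_3 (PFun g n) (PB (g n, n, LTop)).

Inductive ltP1_4 : P1_carrier -> P1_carrier -> Prop :=
  LtP1_4 x : x <> PTop -> ltP1_4 x PTop.

Definition ltP1 (x y : P1_carrier) : Prop :=
  ltP1_1 x y \/ ltP1_2 x y \/ ltP1_3 x y \/ ltP1_4 x y \/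
  rel_comp ltP1_1 ltP1_3 x y.

Lemma leL_trans u v w : leL u v -> leL v w -> leL u w.
Proof.
case: u v w => [p x|] [q y|] [r z|] //= [-> xy] [-> yz]; split=> //.
case: x y z xy yz => [a|s] [b|t] [c|e] //=; first exact: leq_trans.
exact: prefix_trans.
Qed.

Lemma leL_anti u v : leL u v -> leL v u -> u = v.
Proof.
case: u v => [p x|] [q y|] //= [-> xy] [_ yx]; congr LPt.
case: x y xy yx => [a|s] [b|t] //=.
  by move=> ab ba; congr MNat; apply/eqP; rewrite eqn_leq ab.
rewrite /le_word => /[dup] /size_prefix st /prefixP[w tE] /size_prefix ts.
congr MWord; apply: val_inj; rewrite tE in ts *.
by move: ts; rewrite size_cat -{2}[size _]addn0 leq_add2l leqn0 size_eq0;
  move/eqP->; rewrite cats0.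
Qed.

Lemma ltL_trans u v w : ltL u v -> ltL v w -> ltL u w.
Proof.
move=> [uv nuv] [vw nvw]; split; first exact: leL_trans uv vw.
by move=> uw; subst w; apply: nuv; exact: leL_anti.
Qed.

Lemma sq1_trans x y z : sq1 x y -> sq1 y z -> sq1 x z.
Proof.
move=> xy; case: xy => m n u v uv yz; inversion yz; subst.
by constructor; exact: ltL_trans uv _.
Qed.

Lemma ltB_max m n y : ~ ltB (m, n, LTop) y.
Proof.
have sq1F z : ~ sq1 (m, n, LTop) z.
  by move=> h; inversion h as [? ? ? v [le ne]]; subst; case: v le ne h.
case=> [/sq1F|[h|[h|[h|[[z /sq1F]|[[z /sq1F]|[z /sq1F]]]]]]] //; inversion h.
Qed.

Lemma ltB_trans x y z : ltB x y -> ltB y z -> ltB x z.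
Proof.
have topE w : [\/ sq2 w y, sq3 w y | sq4 w y] -> ltB y z -> ltB x z.
  by case=> h; inversion h; subst => /ltB_max.
case=> [xy|[h|[h|[h|[[w _ h]|[[w _ h]|[w _ h]]]]]]]; last first.
- by apply: topE; apply: Or33 h.
- by apply: topE; apply: Or32 h.
- by apply: topE; apply: Or31 h.
- by apply: topE; apply: Or33 h.
- by apply: topE; apply: Or32 h.
- by apply: topE; apply: Or31 h.
case=> [yz|[h|[h|[h|[[w yw h]|[[w yw h]|[w yw h]]]]]]].
- by left; exact: sq1_trans xy yz.
- by do 4 right; left; exists y.
- by do 5 right; left; exists y.
- by do 6 right; exists y.
- by do 4 right; left; exists w => //; exact: sq1_trans xy yw.
- by do 5 right; left; exists w => //; exact: sq1_trans xy yw.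
- by do 6 right; exists w => //; exact: sq1_trans xy yw.
Qed.

Lemma ltB_irr x : ~ ltB x x.
Proof.
case: x => [[m n] [p x|]]; last exact: ltB_max.
case=> [h|[h|[h|[h|[[w _ h]|[[w _ h]|[w _ h]]]]]]]; inversion h.
by match goal with H : ltL _ _ |- _ => case: H end.
Qed.

Lemma ltP1_irr x : ~ ltP1 x x.
Proof.
case=> [h|[h|[h|[h|[y h h']]]]].
- by inversion h; subst; match goal with H : is_true (_ < _) |- _ =>
    rewrite ltnn in H end.
- by inversion h; subst; match goal with H : ltB _ _ |- _ =>
    exact: ltB_irr H end.
- by inversion h.
- by inversion h.
- by inversion h; subst; inversion h'.
Qed.

Lemma ltP1_trans x y z : ltP1 x y -> ltP1 y z -> ltP1 x z.
Proof.
have topF w : ~ ltP1 PTop w.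
  by move=> [h|[h|[h|[h|[? h _]]]]]; inversion h.
have PBtopE m n w : ltP1 (PB (m, n, LTop)) w -> w = PTop.
  case=> [h|[h|[h|[h|[? h _]]]]]; inversion h => //; subst.
  by match goal with H : ltB _ _ |- _ => have := ltB_max H end.
have toTop w : w <> PTop -> ltP1 w PTop.
  by move=> ?; do 3 right; left; constructor.
case=> [h|[h|[h|[h|[w h h']]]]].
- case: h => g n m nm.
  case=> [h|[h|[h|[h|[w h h']]]]].
  + inversion h; subst; left; constructor.
    by match goal with H : is_true (m < _) |- _ => exact: ltn_trans H end.
  + by inversion h.
  + by do 4 right; exists (PFun g m).
  + by inversion h; subst; exact: toTop.
  + inversion h; subst; do 4 right; exists (PFun g m0) => //; constructor.
    by match goal with H : is_true (m < _) |- _ => exact: ltn_trans H end.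
- case: h => a b ab.
  case=> [h|[h|[h|[h|[w h h']]]]]; inversion h; subst; last exact: toTop.
  right; left; constructor.
  by match goal with H : ltB b _ |- _ => exact: ltB_trans H end.
- by case: h => g n /PBtopE ->; exact: toTop.
- by case: h => w _ /topF.
- by case: h' h => g n h /PBtopE ->; inversion h; exact: toTop.
Qed.

End Orders.

(* The carrier of P_1 does not depend on [f], but its order does. *)
Definition P1 (f : ltpair -> word -> nat) : Type := P1_carrier.

Fact P1_display : Order.disp_t.
Proof. exact: Order.Disp tt tt. Qed.

HB.instance Definition _ f := gen_eqMixin (P1 f).
HB.instance Definition _ f := gen_choiceMixin (P1 f).

Section P1Order.
Variable f : ltpair -> word -> nat.

Definition ltP1b (x y : P1 f) : bool := `[< ltP1 f x y >].

Lemma ltP1b_irr : irreflexive ltP1b.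
Proof. by move=> x; apply/asboolP/ltP1_irr. Qed.

Lemma ltP1b_trans : transitive ltP1b.
Proof.
by move=> y x z /asboolP xy /asboolP yz; apply/asboolP; exact: ltP1_trans yz.
Qed.

(* [Lt_isPOrder] takes [x <= y] to be [x = y] or [x < y]. *)
HB.instance Definition _ :=
  Order.Lt_isPOrder.Build P1_display (P1 f) ltP1b_irr ltP1b_trans.

End P1Order.

(* Main.v *)
(* Let A be an irreducible closed set without the top element of P_1; we look
   for a greatest element of A.  If A contained elements (m, n, T) for unboundedly
   many levels n, a map g choosing such an m for each n would have all of its
   (g, k) in A, hence their supremum, the top element.
   If A contains some (m, n, T), take n maximal.  The codes f_p s form a forest
   (s below s.x), and the elements of A at level n that descend from a given m
   form a relatively open set; by irreducibility, the m with (m, n, T) in A are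
   therefore pairwise comparable, so such an m has at most one child x with
   (f_p(s.x), n, T) in A.  Discarding the finitely many ranks up to x leaves a
   neighbourhood of (m, n, T) in A that lies below (m, n, T), and irreducibility
   makes (m, n, T) the greatest element of A.
   If A contains no (m, n, T), all its elements are compact, so irreducibility
   makes A directed, and its supremum is its greatest element. *)
Require Import Defs.
From mathcomp Require Import all_boot all_order.
From mathcomp Require Import boolp classical_sets topology.

Set Implicit Arguments.
Unset Strict Implicit.
Unset Printing Implicit Defensive.

Import Order.TTheory.
Local Open Scope classical_set_scope.

(** * Scott closed sets and irreducibility in an arbitrary poset *)

Section ScottClosed.
Context {d : Order.disp_t} {T : porderType d}.
Implicit Types (A D U V : set T) (x y : T).

Lemma scott_closedP A :
  closed (A : set (scott_space T)) <->
  (forall x y, (x <= y)%O -> A y -> A x) /\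
  (forall D x, directed D -> supremums D x -> D `<=` A -> A x).
Proof.
rewrite -openC; split=> [[upA opA]|[loA clA]].
  split=> [x y xy Ay|D x dirD Dx DA].
    by apply: contrapT => nAx; exact: upA xy nAx Ay.
  apply: contrapT => nAx; have [y [Dy nAy]] := opA D x dirD Dx nAx.
  exact: nAy (DA y Dy).
split=> [x y xy nAx /(loA _ _ xy)//|D x dirD Dx nAx].
apply/set0P/eqP => D0; apply/nAx/(clA D) => // y Dy.
by apply: contrapT => nAy; have : (D `&` ~` A) y by []; rewrite D0.
Qed.

Lemma closed_le x : closed ([set y | (y <= x)%O] : set (scott_space T)).
Proof.
apply/scott_closedP; split=> [y z yz /=|D y dirD [_ lbDy] Dx].
  exact: le_trans.
exact: lbDy.
Qed.

Lemma scott_closure1 x :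
  closure ([set x] : set (scott_space T)) = [set y | (y <= x)%O].
Proof.
apply/seteqP; split=> y.
  rewrite closureE; apply; split; first exact: closed_le.
  by move=> _ ->; exact: lexx.
move=> /= yx; have /scott_closedP[lo _] :=
  @closed_closure (scott_space T) [set x].
by apply: lo yx _; exact: subset_closure.
Qed.

(** The closure of a point is its principal down-set, so a closed set with a greatest element is the
    closure of that element alone. Complements of principal down-sets separate points. *)
Lemma scott_sober :
  (forall A, closed (A : set (scott_space T)) ->
    irreducible (A : set (scott_space T)) ->
    exists2 x, A x & ubound A x) ->
  sober (scott_space T).
Proof.
move=> grA; split=> [x y xy|A clA irrA].
  have nle (u v : scott_space T) : ~~ ((u : T) <= v)%O ->
      exists U : set (scott_space T), U \in nbhs u /\ v \in ~` U.
    move=> uv; exists (~` [set z : T | (z <= v)%O]); split; rewrite inE.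
      apply: open_nbhs_nbhs; split; last exact/negP.
      by rewrite openC; exact: closed_le.
    by apply; exact: lexx.
  have [xy'|/nle[U UP]] := boolP ((x : T) <= y)%O; last by exists U; left.
  have [yx'|/nle[U UP]] := boolP ((y : T) <= x)%O; last by exists U; right.
  by case/eqP: xy; apply: (@le_anti _ T); rewrite xy'.
have [x Ax ubx] := grA A clA irrA.
have [loA _] := (scott_closedP A).1 clA.
have AE : A = closure ([set x] : set (scott_space T)).
  rewrite scott_closure1; apply/seteqP; split=> y; first exact: ubx.
  by move=> /= yx; exact: loA yx Ax.
exists x; split=> // y; rewrite AE !scott_closure1 => xyE.
apply: (@le_anti _ T); apply/andP; split.
  by have : [set z : T | (z <= x)%O] x := lexx x; rewrite xyE.
by have : [set z : T | (z <= y)%O] y := lexx y; rewrite -xyE.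
Qed.

(** For closed [A], these are the traces on [A] of the Scott open sets. *)
Definition rel_open A U :=
  [/\ U `<=` A, forall x y, (x <= y)%O -> A y -> U x -> U y &
      forall D x, directed D -> supremums D x -> D `<=` A -> U x ->
        D `&` U !=set0].

Lemma rel_open_closedD A U :
  closed (A : set (scott_space T)) -> rel_open A U ->
  closed (A `\` U : set (scott_space T)).
Proof.
move=> /scott_closedP[loA clA] [UA upU opU]; apply/scott_closedP; split.
  move=> x y xy [Ay nUy]; split; first exact: loA xy Ay.
  by move=> Ux; exact/nUy/(upU x).
move=> D x dirD Dx DAU; have DA : D `<=` A by move=> y /DAU[].
split=> [|Ux]; first exact: clA Dx DA.
by have [y [/DAU[]]] := opU D x dirD Dx DA Ux.
Qed.

Lemma irreducible_rel_openI A U V :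
  closed (A : set (scott_space T)) -> irreducible (A : set (scott_space T)) ->
  rel_open A U -> rel_open A V -> U !=set0 -> V !=set0 -> U `&` V !=set0.
Proof.
move=> clA [_ irrA] oU oV [x Ux] [y Vy].
have [UA _ _] := oU; have [VA _ _] := oV.
apply/set0P/eqP => UV0.
have [z Az||] := irrA _ _ (rel_open_closedD clA oU) (rel_open_closedD clA oV).
- have [Uz|nUz] := pselect (U z); last by left.
  right; split=> // Vz; have : (U `&` V) z by [].
  by rewrite UV0.
- by move=> /(_ x (UA x Ux))[].
- by move=> /(_ y (VA y Vy))[].
Qed.

(** The down-set of [x] and the closed set [A \ U] cover [A]; the latter misses [x], so
    irreducibility selects the former. *)
Lemma irreducible_greatest A U x :
  closed (A : set (scott_space T)) -> irreducible (A : set (scott_space T)) ->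
  rel_open A U -> U x -> ubound U x -> ubound A x.
Proof.
move=> clA [_ irrA] oU Ux Ule; have [UA _ _] := oU.
have [z Az|//|] := irrA _ _ (@closed_le x) (rel_open_closedD clA oU).
  by have [/Ule|] := pselect (U z); [left|right].
by move=> /(_ x (UA x Ux))[].
Qed.

Lemma directed_maximal D x :
  directed D -> D x -> (forall y, D y -> (x <= y)%O -> y = x) -> ubound D x.
Proof.
move=> [_ dirD] Dx maxx y Dy; have [z [Dz xz yz]] := dirD x y Dx Dy.
by rewrite -(maxx z Dz xz).
Qed.

End ScottClosed.

(** * Prefixes, and ranks in M *)

Lemma prefix_size (T : eqType) (s t u : seq T) :
  prefix s u -> prefix t u -> size s <= size t -> prefix s t.
Proof.
by rewrite !prefixE => /eqP su /eqP tu st; rewrite -tu take_takel// su.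
Qed.

Definition rankM (y : M) : nat :=
  match y with MNat k => k | MWord s => size (val s) end.

Lemma rankM_leM y z : leM y z -> rankM y <= rankM z.
Proof. by case: y z => [a|s] [b|t] //=; exact: size_prefix. Qed.

Lemma leM_rankM_eq y z : leM y z -> rankM z <= rankM y -> y = z.
Proof.
case: y z => [a|s] [b|t] //=.
  by move=> ab ba; congr MNat; apply/eqP; rewrite eqn_leq ab.
rewrite /le_word => /prefixP[w tE]; rewrite tE size_cat.
rewrite -[leqRHS]addn0 leq_add2l leqn0 size_eq0 => /eqP w0.
by congr MWord; apply: val_inj; rewrite tE w0 cats0.
Qed.

(** * The order of P_1: what lies above each kind of element *)

Section P1Theory.
Variable f : ltpair -> word -> nat.
Implicit Types (g : nat -> nat) (k m n : nat) (p : ltpair) (y : M) (s w : word).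
Implicit Types (A D : set (P1 f)) (x z : P1 f).

Let Fun g k : P1 f := PFun g k.
Let Pt m n p y : P1 f := PB (m, n, LPt p y).
Let Top m n : P1 f := PB (m, n, LTop).
Let PT : P1 f := PTop.

Lemma leP1P x z : (x <= z)%O <-> x = z \/ ltP1 f x z.
Proof.
rewrite le_eqVlt; split=> [/orP[/eqP->|/asboolP]|[->|/asboolP xz]].
- by left.
- by right.
- by rewrite eqxx.
- by apply/orP; right.
Qed.

Lemma le_PT x : (x <= PT)%O.
Proof.
apply/leP1P; have [->|xT] := pselect (x = PT); first by left.
by right; do 3 right; left; constructor.
Qed.

Lemma PT_le x : (PT <= x)%O -> x = PT.
Proof. by case/leP1P=> [//|[h|[h|[h|[h|[? h _]]]]]]; inversion h. Qed.

Lemma Top_le m n x : (Top m n <= x)%O -> x = Top m n \/ x = PT.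
Proof.
case/leP1P=> [<-|]; first by left.
case=> [h|[h|[h|[h|[? h _]]]]]; inversion h; last by right.
by subst; match goal with H : ltB _ _ _ |- _ => have := ltB_max H end.
Qed.

Lemma Fun_le_Fun g j k : j <= k -> (Fun g j <= Fun g k)%O.
Proof.
rewrite leq_eqVlt => /orP[/eqP->|jk]; first exact: lexx.
by apply/leP1P; right; left; constructor.
Qed.

Lemma Fun_le_Top g k : (Fun g k <= Top (g k) k)%O.
Proof. by apply/leP1P; right; do 2 right; left; constructor. Qed.

Lemma Fun_le g k x : (Fun g k <= x)%O ->
  [\/ exists2 j, k <= j & x = Fun g j,
      exists2 j, k <= j & x = Top (g j) j | x = PT].
Proof.
case/leP1P=> [<-|]; first by apply: Or31; exists k.
case=> [h|[h|[h|[h|[w h h']]]]].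
- by inversion h; subst; apply: Or31; exists m => //; exact: ltnW.
- by inversion h.
- by inversion h; subst; apply: Or32; exists k.
- by inversion h; subst; apply: Or33.
- inversion h; subst; inversion h'; subst; apply: Or32; exists m => //.
  exact: ltnW.
Qed.

Lemma Pt_le_Top m n p y : (Pt m n p y <= Top m n)%O.
Proof. by apply/leP1P; right; right; left; do 2 constructor; constructor. Qed.

Let sq234 (u v : B) := [\/ sq2 f u v, sq3 f u v | sq4 f u v].

Lemma ltB_cases (u v : B) :
  ltB f u v -> sq1 u v \/ exists2 t, t = u \/ sq1 u t & sq234 t v.
Proof.
case=> [|h]; [by left|right].
case: h => [h|[h|[h|[[t ut h]|[[t ut h]|[t ut h]]]]]].
- by exists u; [left|apply: Or31].
- by exists u; [left|apply: Or32].
- by exists u; [left|apply: Or33].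
- by exists t; [right|apply: Or31].
- by exists t; [right|apply: Or32].
- by exists t; [right|apply: Or33].
Qed.

(* In the second case [w] bounds [y] in both the word order ([sq2]) and the
   order of nat ([sq3]), whence the crude bound on the rank. *)
Lemma Pt_le m n p y x : (Pt m n p y <= x)%O ->
  [\/ exists2 y', leM y y' & x = Pt m n p y',
      exists w, [/\ x = Top (f p w) n.+1 &
                     rankM y <= size (val w) + last 0 (val w)],
      exists s k, [/\ m = f p s, x = Top (f p (word_rcons s k)) n &
                       rankM y <= k] |
      x = Top m n \/ x = PT].
Proof.
have leyy : leM y y by case: y => //= s; exact: prefix_refl.
case/leP1P=> [<-|]; first by apply: Or41; exists y.
case=> [h|[h|[h|[h|[w h _]]]]]; try by inversion h.
  2: by inversion h; apply: Or44; right.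
have {h} [v -> uv] : exists2 v, x = PB v & ltB f (m, n, LPt p y) v.
  by inversion h; exists y0.
have sq1E t : sq1 (m, n, LPt p y) t ->
    t = (m, n, LTop) \/ exists2 y', leM y y' & t = (m, n, LPt p y').
  move=> h; inversion h as [? ? ? z [le _]]; subst.
  by case: z le {h} => [q y' /= [<- yy']|_]; [right; exists y'|left].
case: (ltB_cases uv) => [/sq1E[->|[y' yy' ->]]|[t ut tv]].
- by apply: Or44; left.
- by apply: Or41; exists y'.
have {ut} [y' /rankM_leM yy' tE] : exists2 y', leM y y' & t = (m, n, LPt p y').
  case: ut => [->|/sq1E[tE|//]]; first by exists y.
  by move: tv; rewrite tE => -[] h; inversion h.
rewrite {t}tE in tv; case: tv => h; inversion h; subst.
- apply: Or42; exists x0; split=> //.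
  by apply: leq_trans yy' _; exact: leq_addr.
- by apply: Or42; exists (letter x0); split=> //; exact: leq_trans yy' _.
- by apply: Or43; exists s, x0.
Qed.

(** * Ranks, directed sets and their suprema in P_1 *)

Definition rank x : nat :=
  match x with
  | PFun _ k => k
  | PB (_, _, LPt _ y) => rankM y
  | _ => 0
  end.

(** By [supremums_P1], only these elements can be suprema of a directed set that misses them. Their
    rank 0 is a default value. *)
Definition is_top x : bool :=
  match x with PFun _ _ | PB (_, _, LPt _ _) => false | _ => true end.

Lemma P1P x :
  [\/ exists g k, x = Fun g k, exists m n p y, x = Pt m n p y,
      exists m n, x = Top m n | x = PT].
Proof.
case: x => [g k|[[m n] [p y|]]|]; last exact: Or44.
- by apply: Or41; exists g, k.
- by apply: Or42; exists m, n, p, y.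
- by apply: Or43; exists m, n.
Qed.

Lemma rank_le x z : (x <= z)%O -> ~~ is_top z -> rank x <= rank z.
Proof.
case: (P1P x) => [[g [k ->]]|[m [n [p [y ->]]]]|[m [n ->]]|->] /=.
- by case/Fun_le=> [[j kj ->]|[j _ ->]|->].
- by case/Pt_le=> [[y' /rankM_leM yy' ->]|[w [->]]|[s [k [_ ->]]]|[|]->].
- by case/Top_le=> ->.
- by move/PT_le ->.
Qed.

Lemma rank_le_eq x z :
  (x <= z)%O -> ~~ is_top z -> rank z <= rank x -> z = x.
Proof.
case: (P1P x) => [[g [k ->]]|[m [n [p [y ->]]]]|[m [n ->]]|->] /=.
- case/Fun_le=> [[j kj ->]|[j _ ->]|->] //= _ jk.
  by congr PFun; apply/eqP; rewrite eqn_leq jk.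
- case/Pt_le=> [[y' yy' ->]|[w [->]]|[s [k [_ ->]]]|[|]->] //= _.
  by move=> /(leM_rankM_eq yy') ->.
- by case/Top_le=> ->.
- by move/PT_le ->.
Qed.

(** Each member has another one strictly above it, and such a step raises the rank. A member
    [Top m n] would force [PT] into [D] as its greatest element. *)
Lemma directed_unbounded D : directed D -> (forall x, D x -> ~ ubound D x) ->
  (forall x, D x -> ~~ is_top x) /\ forall r, exists2 x, D x & r < rank x.
Proof.
move=> dirD nmax.
have step x : D x -> exists z, [/\ D z, (x <= z)%O & z <> x].
  move=> Dx; apply: contrapT => noz; apply: (nmax x Dx).
  apply: directed_maximal dirD Dx _ => y Dy xy.
  by apply: contrapT => yx; apply: noz; exists y.
have ntop x : D x -> ~~ is_top x.
  case: (P1P x) => [[g [k ->]]|[m [n [p [y ->]]]]|[m [n ->]]|->] // Dx;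
    have [z [Dz xz ne]] := step _ Dx; last by case: ne; exact: PT_le.
  have [//|zT] := Top_le xz; rewrite zT in Dz.
  by case: (nmax _ Dz) => u _; exact: le_PT.
split=> //; elim=> [|r [x Dx rx]].
  have [x Dx] := dirD.1; have [z [Dz xz ne]] := step x Dx; exists z => //.
  rewrite (leq_ltn_trans (leq0n (rank x)))// ltnNge.
  by apply/negP => /(rank_le_eq xz (ntop z Dz)).
have [z [Dz xz ne]] := step x Dx; exists z => //.
apply: leq_ltn_trans rx _; rewrite ltnNge.
by apply/negP => /(rank_le_eq xz (ntop z Dz)).
Qed.

(** Non-top elements above [Pt m n p y] keep [m], [n] and [p], so the points of this form are
    cofinal in [D]. *)
Lemma directed_Pt D m n p y x :
  directed D -> (forall z, D z -> ~~ is_top z) -> D (Pt m n p y) -> D x ->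
  exists2 y', D (Pt m n p y') & (x <= Pt m n p y')%O.
Proof.
move=> dirD ntop Dy Dx; have [z [Dz xz /Pt_le yz]] := dirD.2 _ _ Dx Dy.
have nz := ntop z Dz; case: yz nz Dz xz =>
  [[y' _ ->]|[w [->]]|[s [k [_ ->]]]|[|]->] // _ Dy' xy'.
by exists y'.
Qed.

Lemma supremums_P1 D x : directed D -> supremums D x ->
  [\/ D x, x = PT |
      exists m n, x = Top m n /\
        forall r, exists p y, D (Pt m n p y) /\ r < rankM y].
Proof.
move=> dirD [ubx lbx]; have [Dx|nDx] := pselect (D x); first exact: Or31.
have [|ntop unb] := directed_unbounded dirD.
  move=> y Dy uby; apply: nDx; suff <- : y = x by [].
  by apply: (@le_anti _ (P1 f)); rewrite ubx //= lbx.
have topx : is_top x.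
  apply/negPn/negP => nx; have [y Dy] := unb (rank x).
  by rewrite ltnNge (rank_le (ubx y Dy) nx).
case: (P1P x) topx ubx lbx => [[g [k ->]]|[m [n [p [y ->]]]]|
  [m [n ->]]|->] // _ ubx lbx; last exact: Or32.
apply: Or33; exists m, n; split=> //.
have PtE r : exists m' n' p y, D (Pt m' n' p y) /\ r < rankM y.
  (* A rank above [n] excludes [Fun g k], which lies below [Top m n] only if [k <= n]. *)
  have [z Dz] := unb (maxn r n); rewrite gtn_max => /andP[rz nz].
  case: (P1P z) Dz rz nz (ubx z Dz) (ntop z Dz) =>
    [[g [k ->]]|[m' [n' [p [y ->]]]]|[m' [n' ->]]|->] // Dz rz nz.
    case/Fun_le=> [[j _ //]|[j kj [_ jn]]|//].
    by move: nz => /=; rewrite jn ltnNge kj.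
  by exists m', n', p, y.
have [m0 [n0 [p [y [D0 _]]]]] := PtE 0.
have cof z := @directed_Pt D m0 n0 p y z dirD ntop D0.
have ubT : ubound D (Top m0 n0).
  by move=> z /cof[y' _ zy']; exact: le_trans zy' (Pt_le_Top m0 n0 p y').
(* The supremum [Top m n] lies below the bound [Top m0 n0], hence equals it, since only [PT] lies
   strictly above [Top m n]. *)
have [TE r|//] := Top_le (lbx _ ubT).
have [m' [n' [q [z [Dz rz]]]]] := PtE r.
have [y' Dy' /Pt_le[[z' _ zE]|[w [//]]|[s [k [_ //]]]|[|] //]] := cof _ Dz.
by case: TE zE Dz => <- <- [<- <- _ _] Dz; exists q, z.
Qed.

Lemma supremums_Fun g : supremums (range (Fun g)) PT.
Proof.
split=> [x _|x ubx]; first exact: le_PT.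
have le k : (Fun g k <= x)%O by apply: ubx; exists k.
case: (P1P x) le => [[h [k ->]]|[m [n [p [y ->]]]]|[m [n ->]]|->] le.
- by case/Fun_le: (le k.+1) => [[j kj [_ jE]]|[]|] //; rewrite jE ltnn in kj.
- by case/Fun_le: (le 0) => [[]|[]|].
- by case/Fun_le: (le n.+1) => [[]//|[j nj [_ jE]]|] //; rewrite jE ltnn in nj.
- exact: lexx.
Qed.

Lemma closed_Fun A g :
  closed (A : set (scott_space (P1 f))) -> (forall k, A (Fun g k)) -> A PT.
Proof.
move=> /scott_closedP[_ clA] Ag; apply: clA (supremums_Fun g) _.
  split=> [|_ _ [j _ <-] [k _ <-]]; first by exists (Fun g 0); exists 0.
  exists (Fun g (maxn j k)); split; first by exists (maxn j k).
    by apply: Fun_le_Fun; exact: leq_maxl.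
  by apply: Fun_le_Fun; exact: leq_maxr.
by move=> _ [k _ <-].
Qed.

Lemma closed_levels A : closed (A : set (scott_space (P1 f))) -> ~ A PT ->
  exists N, forall m n, A (Top m n) -> n <= N.
Proof.
move=> clA nAT; apply: contrapT => noN; have [loA _] := (scott_closedP A).1 clA.
(* Levels without a top in [A] get the default value 0; each [Fun g k] is placed in [A] through a
   later level that has one. *)
have /choice[g gP] n : exists j, forall m, A (Top m n) -> A (Top j n).
  have [[j Aj]|nex] := pselect (exists j, A (Top j n)); first by exists j.
  by exists 0 => m Am; case: nex; exists m.
apply/nAT/(@closed_Fun A g) => // k.
have [m [n [Amn kn]]] : exists m n, A (Top m n) /\ k <= n.
  apply: contrapT => nex; apply: noN; exists k => m n Amn.
  by case: (leqP n k) => // /ltnW kn; case: nex; exists m, n.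
apply: loA (gP _ _ Amn).
exact: le_trans (Fun_le_Fun g kn) (Fun_le_Top g n).
Qed.

(** A directed supremum that is not a top already belongs to the directed set. *)
Lemma rel_open_upper A (U : set (P1 f)) :
  (forall x, A x -> ~~ is_top x) -> U `<=` A ->
  (forall x z, (x <= z)%O -> A z -> U x -> U z) -> rel_open A U.
Proof.
move=> ntop UA upU; split=> // D x dirD Dx _ Ux; have Ax := ntop _ (UA _ Ux).
case: (supremums_P1 dirD Dx) Ax Ux => [Dx' _ Ux|->//|[m [n [-> _]]] //].
by exists x.
Qed.

(** * Irreducible closed sets of P_1, for jointly injective codes [f p s] *)

Section Sober.
Hypothesis f_pair_inj : forall p q s w, f p s = f q w -> p = q /\ s = w.

Lemma Pt_le_TopP m n p y m' n' : (Pt m n p y <= Top m' n')%O ->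
  Top m n = Top m' n' \/
  exists w, m' = f p w /\ rankM y <= size (val w) + last 0 (val w).
Proof.
case/Pt_le=> [[]|[w [[-> _] yw]]|[s [k [_ [-> _] yk]]]|[->|]] //.
- by right; exists w.
- right; exists (word_rcons s k); split=> //=.
  by rewrite last_rcons (leq_trans yk)// leq_addl.
- by left.
Qed.

(** Any other [Top m' n'] above some point of the chain has as [m'] the code of a single word, whose
    length and last letter cap the ranks below it; the ranks in [D] are unbounded. *)
Lemma supremums_Pt D m n p y :
  directed D -> (forall x, D x -> ~~ is_top x) ->
  (forall r, exists2 x, D x & r < rank x) -> D (Pt m n p y) ->
  supremums D (Top m n).
Proof.
move=> dirD ntop unb Dy; have cof x := @directed_Pt D m n p y x dirD ntop Dy.
split=> [x /cof[y' _ xy']|x ubx]; first exact: le_trans xy' (Pt_le_Top _ _ _ _).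
have unb' r : exists y', r < rankM y' /\ (Pt m n p y' <= x)%O.
  have [z Dz rz] := unb r; have [y' Dy' zy'] := cof z Dz.
  exists y'; split; last exact: ubx.
  by apply: leq_trans rz _; exact: (rank_le zy').
case: (P1P x) unb' => [[g [k ->]]|[m' [n' [q [z ->]]]]|[m' [n' ->]]|->] unb'.
- by have [y' [_ /Pt_le[[]|[? []]|[? [? []]]|[]]]] := unb' 0.
- have [y' [lt /rank_le]] := unb' (rankM z).
  by rewrite leqNgt /= lt => /(_ isT).
- have [->|ne] := pselect (Top m n = Top m' n'); first exact: lexx.
  have [_ [_ /Pt_le_TopP[//|[w [m'E _]]]]] := unb' 0.
  have [y' [yw /Pt_le_TopP[//|[w' [m'E']]]]] :=
    unb' (size (val w) + last 0 (val w)).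
  have [_ <-] : p = p /\ w = w' by apply: f_pair_inj; rewrite -m'E.
  by rewrite leqNgt yw.
- exact: le_PT.
Qed.

(** Without a greatest element, the directed set [A] would have unbounded ranks, and closedness
    would put a top into it: [PT] if it contains some [Fun g k], [Top m n] if it contains some
    [Pt m n p y]. *)
Lemma irreducible_no_top A : closed (A : set (scott_space (P1 f))) ->
  irreducible (A : set (scott_space (P1 f))) ->
  (forall x, A x -> ~~ is_top x) -> exists2 x, A x & ubound A x.
Proof.
move=> clA irrA ntop; have [loA supA] := (scott_closedP A).1 clA.
have dirA : directed A.
  split; first exact: irrA.1.
  have op x : rel_open A (A `&` [set z | (x <= z)%O]).
    apply: rel_open_upper ntop _ _ => [z []//|y z yz Az [_ xy]].
    by split=> //; exact: le_trans xy yz.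
  move=> x z Ax Az; have [||t [[At xt] [_ zt]]] :=
      irreducible_rel_openI clA irrA (op x) (op z).
  - by exists x; split=> //; exact: lexx.
  - by exists z; split=> //; exact: lexx.
  - by exists t.
apply: contrapT => nmax; have [|_ unb] := directed_unbounded dirA.
  by move=> x Ax ubx; apply: nmax; exists x.
have [x Ax] := irrA.1.
case: (P1P x) Ax => [[g [k ->]]|[m [n [p [y ->]]]]|[m [n ->]]|->] Ax.
- suff /ntop : A PT by [].
  apply: closed_Fun clA _ => j; have [z Az jz] := unb j.
  have [t [At /Fun_le xt zt]] := dirA.2 _ _ Ax Az.
  have zt' := rank_le zt (ntop t At).
  have nt := ntop t At; case: xt zt' nt At => [[i _ ->]|[i _ ->]|->] //= zi _.
  apply: loA; apply: Fun_le_Fun; exact: leq_trans (ltnW jz) zi.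
- have supT := supremums_Pt dirA ntop unb Ax.
  by have /ntop := supA _ _ dirA supT (@subset_refl _ A).
- by have := ntop _ Ax.
- by have := ntop _ Ax.
Qed.

(* The order of the forest of codes at a fixed level, generated by [sq4]. *)
Definition desc m m' :=
  m = m' \/ exists p s w, [/\ m = f p s, m' = f p w & le_word s w].

Lemma desc_rcons m p s k : desc m (f p s) -> desc m (f p (word_rcons s k)).
Proof.
have sk : le_word s (word_rcons s k) by exact: prefix_rcons.
case=> [->|[q [t [w [-> /f_pair_inj[<- <-] ts]]]]]; right.
  by exists p, s, (word_rcons s k).
by exists p, t, (word_rcons s k); split=> //; exact: prefix_trans ts sk.
Qed.

(** Two prefixes of one word are comparable, and injectivity of the codes makes the word behind [t]
    unique. *)
Lemma desc_total m m' t : desc m t -> desc m' t -> desc m m' \/ desc m' m.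
Proof.
case=> [<-|[p [s [w [-> -> sw]]]]]; first by right.
case=> [->|[q [s' [w' [-> /f_pair_inj[<- <-] sw']]]]].
  by left; right; exists p, s, w.
have [le|le] := leqP (size (val s)) (size (val s')).
  left; right; exists p, s, s'; split=> //; exact: prefix_size sw sw' le.
right; right; exists p, s', s; split=> //; exact: prefix_size sw' sw (ltnW le).
Qed.

Lemma irreducible_level A n : closed (A : set (scott_space (P1 f))) ->
  irreducible (A : set (scott_space (P1 f))) -> ~ A PT ->
  (exists m, A (Top m n)) -> (forall m, ~ A (Top m n.+1)) ->
  exists2 x, A x & ubound A x.
Proof.
move=> clA irrA nAT [m Am] nA1; have [loA _] := (scott_closedP A).1 clA.
(* As [A] has no top at level [n.+1], the only way to leave a column inside [A] is [sq4], which
   moves to a child on the same level. *)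
pose U m := [set x | A x /\ exists m' u, x = PB (m', n, u) /\ desc m m'].
have opU m' : rel_open A (U m').
  split=> [x []//| | D x dirD Dx DA [Ax [m1 [u [xE d1]]]]].
    move=> x z xz Az [Ax [m1 [[p y|] [xE d1]]]].
      split=> //; rewrite {}xE in xz.
      case/Pt_le: xz Az d1 =>
        [[y' _ ->]|[w [-> _]]|[s [k [-> -> _]]]|[->|->]] //.
      - by move=> _ d1; exists m1, (LPt p y').
      - by move=> /nA1.
      - move=> _ d1; exists (f p (word_rcons s k)), LTop; split=> //.
        exact: desc_rcons.
      - by move=> _ d1; exists m1, LTop.
    rewrite {}xE in xz; split=> //; case/Top_le: xz Az => -> // _.
    by exists m1, LTop.
  have [Dx'|xT|[m2 [n2 [xE2 /(_ 0)[p [y [Dy _]]]]]]] := supremums_P1 dirD Dx.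
  - by exists x; split=> //; split=> //; exists m1, u.
  - by rewrite xT in Ax.
  - exists (Pt m2 n2 p y); split=> //; split; first exact: DA.
    by move: xE; rewrite xE2 => -[-> -> _]; exists m1, (LPt p y).
have cmp m1 m2 : A (Top m1 n) -> A (Top m2 n) -> desc m1 m2 \/ desc m2 m1.
  move=> A1 A2; have U0 m' : A (Top m' n) -> U m' !=set0.
    move=> A'; exists (Top m' n); split=> //.
    by exists m', LTop; split=> //; left.
  have [t [[_ [m' [u [-> d1]]]] [_ [m'' [u' [[<- _] d2]]]]]] :=
    irreducible_rel_openI clA irrA (opU m1) (opU m2) (U0 _ A1) (U0 _ A2).
  exact: desc_total d1 d2.
(* Siblings have equal length, so one is a prefix of the other only if they coincide. *)
have desc_sib p s k l :
    desc (f p (word_rcons s k)) (f p (word_rcons s l)) -> k = l.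
  have le_rcons : le_word (word_rcons s k) (word_rcons s l) -> k = l.
    rewrite /le_word prefixE /= !size_rcons -(size_rcons (val s) l) take_size.
    by rewrite eqseq_rcons => /andP[_ /eqP].
  move=> d1; apply: le_rcons.
  case: d1 => [/f_pair_inj[_ ->]|
    [q [t [w [/f_pair_inj[_ ->] /f_pair_inj[_ ->]]]]]] //.
  exact: prefix_refl.
(* Two distinct children of [m] with tops in [A] would be incomparable, contradicting [cmp]; the
   letter of the only child serves as [r], or 0 if there is none. *)
have [r rP] : exists r, forall p s k, m = f p s ->
    A (Top (f p (word_rcons s k)) n) -> k <= r.
  have [[p [s [k [mE Ak]]]]|nex] := pselect (exists p s k, m = f p s /\
    A (Top (f p (word_rcons s k)) n)); last first.
    by exists 0 => p s k mE Ak; case: nex; exists p, s, k.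
  exists k => q t l; rewrite mE => /f_pair_inj[<- <-] Al.
  suff -> : l = k by [].
  by case: (cmp _ _ Ak Al) => /desc_sib.
(* From rank above [r], [sq4] only reaches children with letter above [r], whose tops are not in
   [A]. [Top m n] satisfies the rank condition vacuously. *)
pose V := [set x | A x /\ exists u, x = PB (m, n, u) /\
  forall p y, u = LPt p y -> r < rankM y].
have opV : rel_open A V.
  split=> [x []//|x z xz Az [Ax [[p y|] [xE ry]]]|
    D x dirD Dx DA [Ax [u [xE ru]]]].
  - split=> //; rewrite {}xE in xz; have {}ry := ry _ _ erefl.
    case/Pt_le: xz Az => [[y' yy' ->]|[w [-> _]]|[s [k [mE -> yk]]]|[->|->]] //.
    + exists (LPt p y'); split=> // _ _ [_ <-].
      exact: leq_trans ry (rankM_leM yy').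
    + by move=> /nA1.
    + by move=> /(rP _ _ _ mE); rewrite leqNgt (leq_trans ry yk).
    + by exists LTop.
  - rewrite {}xE in xz; split=> //; case/Top_le: xz Az => -> // _.
    by exists LTop.
  (* Instantiating at [r] yields a point of [D] of large enough rank to lie in [V]. *)
  - have [Dx'|xT|[m2 [n2 [xE2 /(_ r)[p [y [Dy ry]]]]]]] := supremums_P1 dirD Dx.
    + by exists x; split=> //; split=> //; exists u.
    + by rewrite xT in Ax.
    + exists (Pt m2 n2 p y); split=> //; split; first exact: DA.
      move: xE; rewrite xE2 => -[-> -> _]; exists (LPt p y); split=> //.
      by move=> _ _ [_ <-].
exists (Top m n) => //; apply: irreducible_greatest clA irrA opV _ _.
  by split=> //; exists LTop.
move=> _ [_ [[p y|] [-> _]]]; [exact: Pt_le_Top|exact: lexx].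
Qed.

Lemma P1_sober : sober (scott_space (P1 f)).
Proof.
apply: scott_sober => A clA irrA.
have [AT|nAT] := pselect (A PT).
  by exists PT => // x _; exact: le_PT.
have [N NP] := closed_levels clA nAT.
pose lev n := `[< exists m, A (Top m n) >].
have [exl|nex] := pselect (exists n, lev n); last first.
  apply: irreducible_no_top => // x.
  case: (P1P x) => [[g [k ->]]|[m [n [p [y ->]]]]|[m [n ->]]|->] // Am.
  by case: nex; exists n; apply/asboolP; exists m.
have levN n : lev n -> n <= N by move=> /asboolP[m /NP].
(* The highest level with a top in [A], which exists by [closed_levels]. *)
case: (ex_maxnP exl levN) => n /asboolP An maxn.
apply: (@irreducible_level A n) => // m Am.
suff /maxn : lev n.+1 by rewrite ltnn.
by apply/asboolP; exists m.
Qed.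

End Sober.
End P1Theory.

Theorem lemma4p8
  (i : ltpair -> set nat)
  (i_inj : injective i)
  (i_disj : forall p q : ltpair, p <> q -> i p `&` i q = set0)
  (i_gt : forall (p : ltpair) (k : nat), i p k -> (val p).2 < k)
  (f : ltpair -> word -> nat)
  (f_in : forall (p : ltpair) (s : word), i p (f p s))
  (f_mono : forall (p : ltpair) (s t : word), le_word s t -> f p s <= f p t)
  (f_inj : forall p : ltpair, injective (f p)) :
  sober (scott_space (P1 f)).
Proof.
apply: P1_sober => p q s w fE.
(* A shared code would lie in the two disjoint sets [i p] and [i q]. *)
have pq : p = q.
  apply: contrapT => /i_disj ipq.
  by have : (i p `&` i q) (f p s); [split=> //; rewrite fE|rewrite ipq].
by split=> //; apply: (f_inj p); rewrite fE pq.
Qed.
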